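(* Let $(X,d,\mu)$ be a metric measure space and let $1\le p\le q<\infty$. Then $$\mathrm{Lip}_b(X)\subset NM_p^q(X)\subset N^{1,p}_{\mathrm{loc}}(X),$$ where $\mathrm{Lip}_b(X)$ is the set of all Lipschitz functions on $X$ with bounded support, $NM_p^q(X)$ is the Newton-Morrey-Sobolev space, and $N^{1,p}_{\mathrm{loc}}(X)$ is the collection of functions which belong to the Newton-Sobolev space $N^{1,p}(B)$ for every ball $B\subset X$.
   Context: Throughout, $(X,d,\mu)$ is a metric space with a non-trivial Borel regular measure $\mu$ which is finite on bounded sets and positive on (non-empty) open sets. Morrey space: for $1\le p\le q<\infty$, $\mathcal{M}_p^q(X)$ is the space of all measurable functions $f$ on $X$ with $$\|f\|_{\mathcal{M}_p^q(X)}:=\sup_{B\subset X}[\mu(B)]^{1/q-1/p}\left[\int_B|f(x)|^p\,d\mu(x)\right]^{1/p}<\infty,$$ the supremum being over all balls $B$ in $X$. When $p=q$ this is $L^p(X)$. Curves: a curve is a continuous mapping from an interval into $X$; it is rectifiable if its length is finite; rectifiable curves are always arc-length parameterized, and $l(\gamma)$ denotes the length of $\gamma$. For a family $\Gamma$ of rectifiable curves, $F(\Gamma)$ is the set of Borel measurable functions $\rho:X\to[0,\infty]$ with $\int_\gamma\rho\,ds\ge 1$ for all $\gamma\in\Gamma$ (so $F(\Gamma)=\emptyset$ if $\Gamma$ contains a constant curve). The Morrey-modulus is $\mathrm{Mod}_p^q(\Gamma):=\inf_{\rho\in F(\Gamma)}\|\rho\|_{\mathcal{M}_p^q(X)}^p$,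 with $\inf\emptyset=\infty$. A non-negative Borel function $g$ is an upper gradient of a measurable function $f$ if $$|f\circ\gamma(0)-f\circ\gamma(l(\gamma))|\le\int_\gamma g\,ds$$ for all non-constant rectifiable curves $\gamma$ in $X$; it is a $\mathrm{Mod}_p^q$-weak upper gradient of $f$ if this inequality holds for all non-constant rectifiable curves except a family of Morrey-modulus zero. $\widetilde{NM_p^q}(X)$ is the set of measurable $f$ with $\|f\|_{\widetilde{NM_p^q}(X)}:=\|f\|_{\mathcal{M}_p^q(X)}+\inf\|g\|_{\mathcal{M}_p^q(X)}<\infty$, the infimum over all $\mathrm{Mod}_p^q$-weak upper gradients $g$ of $f$. The Newton-Morrey-Sobolev space $NM_p^q(X)$ is the quotient of $\widetilde{NM_p^q}(X)$ by $\{f:\|f\|_{\widetilde{NM_p^q}(X)}=0\}$, with the induced norm. The Newton-Sobolev space is $N^{1,p}(X):=NM_p^p(X)$ (so the modulus is the usual $p$-modulus), and $N^{1,p}(B)$ is this space for the ball $B$ considered as a metric measure space with the restrictions of $d$ and $\mu$. Functions are identified with their equivalence classes. *)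

(* Defs.v *)
From HB Require Import structures.
From mathcomp Require Import all_boot all_order all_algebra.
From mathcomp Require Import all_classical all_reals all_analysis.
From mathcomp Require Import measurable_realfun.

Set Implicit Arguments.
Unset Strict Implicit.
Unset Printing Implicit Defensive.
Import Order.TTheory GRing.Theory Num.Theory.
Import numFieldNormedType.Exports.

Local Open Scope classical_set_scope.
Local Open Scope ring_scope.
Local Open Scope ereal_scope.

(* A measurableType has a distinguished point; this is harmless here since a
   space carrying a non-trivial measure is nonempty. *)
#[short(type="pmetricType")]
HB.structure Definition PMetric (R : numDomainType) :=
  {T of Metric R T & Pointed T}.

Definition bounded_subset (R : realType) (X : pmetricType R) (A : set X) :=
  exists (x : X) (r : R), A `<=` ball x r.

(* Measures on a metric space are defined on all subsets (outer measures), as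
   is customary for Borel regular measures; "measurable" means measurable in
   the sense of Caratheodory. *)
Definition Borel_regular (R : realType) (X : pmetricType R)
    (mu : {outer_measure set X -> \bar R}) :=
  (forall A, <<s @open X >> A -> mu.-caratheodory A) /\
  (forall A, exists B, [/\ <<s @open X >> B, A `<=` B & mu A = mu B]).

Record metric_measure (R : realType) (X : pmetricType R)
    (mu : {outer_measure set X -> \bar R}) : Prop := MetricMeasure {
  mm_regular : Borel_regular mu ;
  mm_nontrivial : mu [set: X] != 0 ;
  mm_finite : forall A, bounded_subset A -> mu A < +oo ;
  mm_positive : forall U, open U -> U !=set0 -> 0 < mu U }.

Definition cara_measure (R : realType) (X : pmetricType R)
    (mu : {outer_measure set X -> \bar R}) :
    {measure set (caratheodory_type mu) -> \bar R} :=
  (mu : set (caratheodory_type mu) -> \bar R).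

Section Morrey.
Context {R : realType} {X : pmetricType R}.
Variable mu : {outer_measure set X -> \bar R}.

Definition morrey_norm (p q : R) (f : X -> \bar R) : \bar R :=
  ereal_sup [set z | exists (x : X) (r : {posnum R}),
    let B := ball x r%:num in
    z = mu B `^ (q^-1 - p^-1) *
        (\int[cara_measure mu]_(y in B) (`|f y| `^ p)) `^ p^-1].

End Morrey.

Section Curves.
Context {R : realType} {X : pmetricType R}.

Definition curve_length (a b : R) (c : R -> X) : \bar R :=
  ereal_sup [set z | exists2 s, itv_partition a b s &
    z = (\sum_(0 <= n < size s)
      mdist (c (nth b (a :: s) n)) (c (nth b (a :: s) n.+1)))%:E].

(* Rectifiable curves, parameterized by arc length on [0, curve_len]; the
   values of curve_fun outside this interval are irrelevant. *)
Record rcurve := RCurve {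
  curve_len : R ;
  curve_fun :> R -> X ;
  curve_len_ge0 : (0 <= curve_len)%R ;
  curve_continuous : {within `[0%R, curve_len], continuous curve_fun} ;
  curve_arclength : forall t, t \in `[0%R, curve_len] ->
    curve_length 0 t curve_fun = t%:E }.

Definition nonconstant (c : rcurve) :=
  exists2 t, t \in `[0%R, curve_len c] & c t <> c 0%R.

Definition line_integral (c : rcurve) (rho : X -> \bar R) : \bar R :=
  \int[lebesgue_measure]_(t in `[0%R, curve_len c]) rho (c t).

Definition nonneg_borel (rho : X -> \bar R) :=
  (forall x, 0 <= rho x) /\
  measurable_fun [set: g_sigma_algebraType (@open X)] rho.

Definition admissible (Gamma : set rcurve) : set (X -> \bar R) :=
  [set rho | nonneg_borel rho /\
             forall c, Gamma c -> 1 <= line_integral c rho].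

End Curves.
Arguments rcurve {R} X.

Section NewtonMorrey.
Context {R : realType} {X : pmetricType R}.
Variable mu : {outer_measure set X -> \bar R}.

(* ereal_inf set0 = +oo *)
Definition Mod (p q : R) (Gamma : set (rcurve X)) : \bar R :=
  ereal_inf [set morrey_norm mu p q rho `^ p | rho in admissible Gamma].

Definition gradient_ineq (f : X -> R) (g : X -> \bar R) (c : rcurve X) :=
  `|f (c 0%R) - f (c (curve_len c))|%:E <= line_integral c g.

Definition weak_upper_gradient (p q : R) (f : X -> R) (g : X -> \bar R) :=
  nonneg_borel g /\
  exists2 Gamma : set (rcurve X), Mod p q Gamma = 0 &
    forall c, nonconstant c -> ~ Gamma c -> gradient_ineq f g c.

Definition NM_norm (p q : R) (f : X -> R) : \bar R :=
  morrey_norm mu p q (EFin \o f) +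
  ereal_inf [set morrey_norm mu p q g | g in weak_upper_gradient p q f].

Definition NM_tilde (p q : R) : set (X -> R) :=
  [set f | measurable_fun [set: caratheodory_type mu]
             f /\
           NM_norm p q f < +oo].

Definition NM_null (p q : R) : set (X -> R) :=
  [set f | NM_tilde p q f /\ NM_norm p q f = 0].

Definition NM_class (p q : R) (f : X -> R) : set (X -> R) :=
  [set h | NM_null p q (h \- f)%R].

(* The quotient of NM_tilde by NM_null, as a set of cosets. *)
Definition NM (p q : R) : set (set (X -> R)) :=
  [set NM_class p q f | f in NM_tilde p q].

Definition Newton (p : R) : set (set (X -> R)) := NM p p.

End NewtonMorrey.

Section Subspace.
Context {R : realType} {X : pmetricType R}.
Variable D : set X.

Let sub_dist (x y : D) : R := mdist (set_val x) (set_val y).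

Let sub_dist_ge0 x y : (0 <= sub_dist x y)%R.
Proof. exact: mdist_ge0. Qed.

Let sub_dist_positivity x y : sub_dist x y = 0%R -> x = y.
Proof. by move=> /mdist_positivity; exact: val_inj. Qed.

Let sub_ballE (x : D) d : ball x d = [set y | (sub_dist x y < d)%R].
Proof. by rewrite -initial_ballE ballEmdist. Qed.

HB.instance Definition _ := PseudoMetric_isMetric.Build R (D : Type)
  sub_dist_ge0 sub_dist_positivity sub_ballE.

Variable mu : {outer_measure set X -> \bar R}.

Definition restr_measure (A : set D) : \bar R := mu (set_val @` A).

Let restr0 : restr_measure set0 = 0.
Proof. by rewrite /restr_measure image_set0 outer_measure0. Qed.

Let restr_ge0 A : 0 <= restr_measure A.
Proof. exact: outer_measure_ge0. Qed.

Let restr_le : {homo restr_measure : A B / A `<=` B >-> A <= B}.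
Proof. by move=> A B AB; apply: le_outer_measure; exact: image_subset. Qed.

Let restr_sub : sigma_subadditive restr_measure.
Proof.
move=> F; rewrite /restr_measure image_bigcup.
exact: outer_measure_sigma_subadditive.
Qed.

HB.instance Definition _ := isOuterMeasure.Build R D restr_measure
  restr0 restr_ge0 restr_le restr_sub.

End Subspace.

Section BallSpace.
Context {R : realType} {X : pmetricType R}.

Definition ball_space (x : X) (r : {posnum R}) : Type :=
  set_type (ball x r%:num).

HB.instance Definition _ x r := Metric.copy (ball_space x r)
  (set_type (ball x r%:num)).
HB.instance Definition _ x r := isPointed.Build (ball_space x r)
  (exist _ x (mem_set (ball_center x r))).

Definition ball_val x r (y : ball_space x r) : X := set_val y.

Definition ball_measure (mu : {outer_measure set X -> \bar R}) x r :
    {outer_measure set (ball_space x r) -> \bar R} :=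
  restr_measure (D := ball x r%:num) mu.

Definition Lip_b : set (X -> R) :=
  [set f | (exists L : R, forall x y, (`|f x - f y| <= L * mdist x y)%R) /\
           bounded_subset (closure [set x | f x != 0%R])].

(* An element F of a space of classes on X is in N^{1,p}_loc when, for every
   ball B, the restrictions to B of all the representatives of F belong to one
   and the same class in N^{1,p}(B). *)
Definition Newton_loc (mu : {outer_measure set X -> \bar R}) (p : R) :
    set (set (X -> R)) :=
  [set F | forall x (r : {posnum R}),
    exists2 G, Newton (ball_measure mu x r) p G &
      forall f : X -> R, F f -> G (f \o @ball_val x r)].

End BallSpace.

(* Main.v *)
Require Import Defs.
From mathcomp Require Import all_boot all_order all_algebra.
From mathcomp Require Import all_classical all_reals all_analysis.
From mathcomp Require Import measurable_realfun.

(** Both inclusions reduce to estimates of the Morrey norm.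

    [Lip_b] in [NM]: let f be L-Lipschitz, bounded by M, with support in the
    ball B(x0, r0).  An arc-length parameterized curve moves at speed at most
    one, so a curve with an end point in B(x0, r0) stays in B(x0, r0 + 1)
    during one unit of time, or during its whole life if it is shorter.  Hence
    (L + 2 M) 1_B(x0, r0 + 1) is an upper gradient of f
    ([lipschitz_gradient_ineq]): a short curve pays at least L times its length, a
    long one at least 2 M, and a curve with neither end in B(x0, r0) owes
    nothing.  Both f and this gradient are bounded with bounded support, and
    such functions have finite Morrey norm because
    mu(B)^(1/q - 1/p) mu(A & B)^(1/p) <= mu(A)^(1/q), the first exponent being
    nonpositive ([morrey_norm_bounded_support]).

    [NM] in [Newton_loc]: fix a ball B, regarded as a metric measure space.
    For p = q the weight in the Morrey norm disappears, so the norm on B is an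
    L^p norm, which is mu(B)^(1/p - 1/q) times one of the terms whose supremum
    is the Morrey norm on X ([morrey_norm_ball_val]).  Curves of B are curves
    of X with the same length, so restricting test functions to B sends a
    curve family of Morrey modulus zero to one of p-modulus zero
    ([Mod_ball_eq0]), and restricted weak upper gradients are again weak upper
    gradients.  Restriction is therefore bounded for the Newton-Morrey norms
    ([NM_norm_ball]); it maps functions of finite norm to functions of finite
    norm, and null functions to null functions, so all representatives of a
    class restrict to a single class. *)

Set Implicit Arguments.
Unset Strict Implicit.
Unset Printing Implicit Defensive.
Import Order.TTheory GRing.Theory Num.Theory.
Import numFieldNormedType.Exports.

Local Open Scope classical_set_scope.
Local Open Scope ring_scope.

(** * Topology and measurability in metric measure spaces *)

Section MetricTopology.
Local Open Scope ereal_scope.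
Context {R : realType} {X : pmetricType R}.

Lemma open_metric_ball (x : X) (r : R) : open (ball x r).
Proof.
rewrite openE => y; rewrite ballEmdist /= => xy.
apply/nbhs_ballP; exists (r - mdist x y)%R => /=; first by rewrite subr_gt0.
move=> z; rewrite ballEmdist /= => yz.
by apply: (le_lt_trans (metric_triangle _ y _)); rewrite addrC -ltrBrDr.
Qed.

(** The modulus of continuity uses [`|L| + 1], as L may be zero or, on a
    one-point space, negative. *)
Lemma lipschitz_continuous (L : R) (f : X -> R) :
  (forall x y, (`|f x - f y| <= L * mdist x y)%R) -> continuous f.
Proof.
move=> Lf x; apply/cvgrPdist_lt => e e0.
have L0 : (0 < `|L| + 1)%R by rewrite ltr_wpDl.
apply/nbhs_ballP; exists (e / (`|L| + 1))%R => /=; first by rewrite divr_gt0.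
move=> y; rewrite ballEmdist /= ltr_pdivlMr// mulrC.
apply: le_lt_trans; apply: (le_trans (Lf x y)).
apply: ler_wpM2r; first exact: mdist_ge0.
by rewrite (le_trans (ler_norm L))// lerDl.
Qed.

Lemma borel_ball (x : X) (r : R) :
  measurable (ball x r : set (g_sigma_algebraType (@open X))).
Proof. by apply: sub_gen_smallest; exact: open_metric_ball. Qed.

Lemma nonneg_borel_scaled_ball (K : R) (x : X) (r : R) : (0 <= K)%R ->
  nonneg_borel (fun y => (K * \1_(ball x r) y)%:E).
Proof.
move=> K0; split; first by move=> y; rewrite lee_fin mulr_ge0.
apply/measurable_EFinP; apply: measurable_funM => //.
by apply: measurable_indic; exact: borel_ball.
Qed.

End MetricTopology.

Section BorelCaratheodory.
Local Open Scope ereal_scope.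
Context {R : realType} {X : pmetricType R}.
Variable mu : {outer_measure set X -> \bar R}.
Hypothesis hmu : metric_measure mu.

Lemma borel_caratheodory (A : set X) :
  measurable (A : set (g_sigma_algebraType (@open X))) ->
  measurable (A : set (caratheodory_type mu)).
Proof. by case: hmu => -[+ _] _ _ _ => /(_ A). Qed.

Lemma borel_fun_caratheodory d (Y : measurableType d) (f : X -> Y) :
  measurable_fun [set: g_sigma_algebraType (@open X)] f ->
  measurable_fun [set: caratheodory_type mu] f.
Proof.
move=> mf _ A mA; apply: borel_caratheodory; exact: (mf measurableT A mA).
Qed.

Lemma continuous_fun_borel (f : X -> R) : continuous f ->
  measurable_fun [set: g_sigma_algebraType (@open X)] f.
Proof.
move=> /continuousP cf; apply: (measurability _ (RGenOpens.measurableE R)).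
move=> _ [_ [a [b ->] <-]]; rewrite setTI; apply: sub_gen_smallest.
exact/cf/interval_open.
Qed.

Lemma caratheodory_ball (x : X) (r : R) :
  measurable (ball x r : set (caratheodory_type mu)).
Proof. by apply: borel_caratheodory; exact: borel_ball. Qed.

(** Positivity and finiteness of mu(B) are what allow powers of mu(B) with
    exponents of either sign to be multiplied and cancelled below. *)
Lemma measure_ball_pos_fin (x : X) (r : {posnum R}) :
  exists2 m : R, (0 < m)%R & mu (ball x r%:num) = m%:E.
Proof.
have lty : mu (ball x r%:num) < +oo by apply: (mm_finite hmu); exists x, r%:num.
have gt0 : 0 < mu (ball x r%:num).
  apply: (mm_positive hmu); first exact: open_metric_ball.
  by exists x; exact: ballxx.
by move: lty gt0; case: (mu _) => // m _ m0; exists m.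
Qed.

End BorelCaratheodory.

(** * The Morrey norm, the modulus and the Newton-Morrey norm *)

Lemma le_poweRr (R : realType) (r : R) (x y : \bar R) :
  0 <= r -> (0 <= x)%E -> (x <= y)%E -> (x `^ r <= y `^ r)%E.
Proof.
move=> r0 x0 xy; apply: (gt0_ler_poweR r0) => //; rewrite in_itv/= leey andbT//.
exact: le_trans xy.
Qed.

Section MorreyNorm.
Local Open Scope ereal_scope.
Context {R : realType} {X : pmetricType R}.
Variable mu : {outer_measure set X -> \bar R}.
Hypothesis hmu : metric_measure mu.
Variables p q : R.
Hypotheses (hp : (1 <= p)%R) (hpq : (p <= q)%R).
Implicit Types f g : X -> \bar R.

Let p_gt0 : (0 < p)%R. Proof. exact: lt_le_trans hp. Qed.
Let q_gt0 : (0 < q)%R. Proof. exact: lt_le_trans hpq. Qed.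

Let pV_neq0 : p^-1%R != 0%R.
Proof. by rewrite gt_eqF// invr_gt0. Qed.

Lemma measurable_abse_poweR d (T : measurableType d) (D : set T)
    (f : T -> \bar R) :
  measurable_fun D f -> measurable_fun D (fun y => `|f y| `^ p).
Proof.
move=> mf; apply: (measurableT_comp (measurable_poweR p)).
exact: measurableT_comp mf.
Qed.

Lemma morrey_norm_ge0 f : 0 <= morrey_norm mu p q f.
Proof.
apply: le_ereal_sup_tmp.
exists (mu (ball (point : X) 1%R) `^ (q^-1 - p^-1) *
  (\int[cara_measure mu]_(y in ball (point : X) 1%R) (`|f y| `^ p)) `^ p^-1).
  by exists point, (PosNum ltr01).
by rewrite mule_ge0 ?poweR_ge0.
Qed.

Lemma morrey_norm_eq0 f : (forall x, f x = 0) -> morrey_norm mu p q f = 0.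
Proof.
move=> f0; apply/eqP; rewrite eq_le morrey_norm_ge0 andbT.
apply: ge_ereal_sup => _ [x [r ->]] /=.
rewrite integral0_eq; first by rewrite poweR0r// mule0.
by move=> y _; rewrite f0 abse0 poweR0r// gt_eqF.
Qed.

(** For a ball B, the integral of |f|^p over B is at most M^p mu(A & B), so
    everything rests on
    mu(B)^(1/q - 1/p) mu(A & B)^(1/p) <= mu(A & B)^(1/q) <= mu(A)^(1/q);
    the first inequality holds as 1/q - 1/p <= 0 and mu(A & B) <= mu(B). *)
Lemma morrey_norm_bounded_support f (M : R) (A : set X) : (0 <= M)%R ->
  measurable_fun [set: caratheodory_type mu] f ->
  measurable (A : set (caratheodory_type mu)) -> bounded_subset A ->
  (forall x, `|f x| <= (M * \1_A x)%:E) ->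
  morrey_norm mu p q f < +oo.
Proof.
move=> M0 mf mA bA fM.
have muA : mu A \is a fin_num.
  by rewrite ge0_fin_numE ?outer_measure_ge0// (mm_finite hmu).
apply: (@le_lt_trans _ _ (M%:E * mu A `^ q^-1)); last first.
  by rewrite ltey_eq fin_numM ?fin_num_poweR.
apply: ge_ereal_sup => _ [x [r ->]] /=; set B := ball x _.
have mB : measurable (B : set (caratheodory_type mu)) by exact: caratheodory_ball.
have [b b0 muB] := measure_ball_pos_fin hmu x r.
have AB_B : mu (A `&` B) <= mu B by apply: le_outer_measure; exact: subIsetr.
have AB_A : mu (A `&` B) <= mu A by apply: le_outer_measure; exact: subIsetl.
have AB0 : 0 <= mu (A `&` B) by exact: outer_measure_ge0.
have intle : \int[cara_measure mu]_(y in B) (`|f y| `^ p) <=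
    (M `^ p)%:E * mu (A `&` B).
  rewrite -(integral_indic (cara_measure mu) mB mA).
  rewrite -ge0_integralZl//; last first.
  - by rewrite lee_fin powR_ge0.
  - by apply/measurable_EFinP; exact: measurable_indic.
  apply: ge0_le_integral => //.
  - by move=> y _; exact: poweR_ge0.
  - by apply: measurable_abse_poweR; exact: measurable_funS mf.
  - by apply: emeasurable_funM => //; apply/measurable_EFinP;
      exact: measurable_indic.
  move=> y _; apply: (@le_trans _ _ ((M * \1_A y)%:E `^ p)).
    by apply: le_poweRr => //; exact: ltW.
  rewrite poweR_EFin -EFinM lee_fin powRM//.
  rewrite indicE; case: (y \in A) => /=; first by rewrite powR1.
  by rewrite powR0 ?gt_eqF.
have intle' : (\int[cara_measure mu]_(y in B) (`|f y| `^ p)) `^ p^-1 <=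
    M%:E * mu (A `&` B) `^ p^-1.
  have -> : M%:E * mu (A `&` B) `^ p^-1 =
      ((M `^ p)%:E * mu (A `&` B)) `^ p^-1.
    rewrite poweRM//; last by rewrite lee_fin powR_ge0.
    by rewrite poweR_EFin -powRrM divff ?gt_eqF// powRr1.
  apply: le_poweRr => //; first by rewrite invr_ge0 ltW.
  by apply: integral_ge0 => y _; exact: poweR_ge0.
apply: (le_trans (lee_wpmul2l (poweR_ge0 _ _) intle')).
rewrite muleCA; apply: lee_wpmul2l; first by rewrite lee_fin.
move: AB0 AB_B AB_A muA; rewrite muB.
case: (mu (A `&` B)) => // c; case: (mu A) => // a.
rewrite !poweR_EFin -EFinM !lee_fin => c0 cb ca _.
(* The case c = 0 is apart because 0 to a negative power is 0, so that
   c^(1/q - 1/p) need not dominate b^(1/q - 1/p). *)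
have [->|cn0] := eqVneq c 0%R; first by rewrite powR0// mulr0 powR_ge0.
have c_gt0 : (0 < c)%R by rewrite lt_neqAle eq_sym cn0.
apply: (@le_trans _ _ (c `^ (q^-1 - p^-1) * c `^ p^-1)%R).
  apply: ler_wpM2r; first exact: powR_ge0.
  rewrite -opprB 2!powRN lef_pV2 ?posrE ?powR_gt0//.
  apply: ge0_ler_powR; rewrite ?nnegrE ?(ltW b0)//.
  by rewrite subr_ge0 lef_pV2 ?posrE.
rewrite -powRD; last by rewrite (negbTE cn0)/= implybT.
rewrite subrK; apply: ge0_ler_powR; rewrite ?nnegrE ?invr_ge0 ?(ltW q_gt0)//.
exact: le_trans ca.
Qed.

Lemma Mod_ge0 (Gamma : set (rcurve X)) : 0 <= Mod mu p q Gamma.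
Proof. by apply: le_ereal_inf_tmp => _ [rho _ <-]; exact: poweR_ge0. Qed.

Lemma Mod_set0 : Mod mu p q set0 = 0.
Proof.
apply/eqP; rewrite eq_le Mod_ge0 andbT; apply: ereal_inf_lbound.
exists (cst 0); last by rewrite morrey_norm_eq0// poweR0r// gt_eqF.
split; last by [].
by split => //; exact: measurable_cst.
Qed.

Lemma NM_norm_ge0 (f : X -> R) : 0 <= NM_norm mu p q f.
Proof.
apply: adde_ge0; first exact: morrey_norm_ge0.
by apply: le_ereal_inf_tmp => _ [g _ <-]; exact: morrey_norm_ge0.
Qed.

Lemma NM_norm_lty (f : X -> R) (g : X -> \bar R) :
  weak_upper_gradient mu p q f g ->
  morrey_norm mu p q (EFin \o f) < +oo -> morrey_norm mu p q g < +oo ->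
  NM_norm mu p q f < +oo.
Proof.
move=> fg fy gy; apply: lte_add_pinfty => //.
by apply: le_lt_trans gy; apply: ereal_inf_lbound; exists g.
Qed.

Lemma upper_gradient_weak (f : X -> R) (g : X -> \bar R) :
  nonneg_borel g -> (forall c : rcurve X, gradient_ineq f g c) ->
  weak_upper_gradient mu p q f g.
Proof. by move=> bg fg; split => //; exists set0; [exact: Mod_set0|]. Qed.

Lemma NM_null0 : NM_null mu p q (fun=> 0%R).
Proof.
have E : NM_norm mu p q (fun=> 0%R) = 0.
  apply/eqP; rewrite eq_le NM_norm_ge0 andbT /NM_norm morrey_norm_eq0// add0e.
  apply: ereal_inf_lbound; exists (cst 0); last exact: morrey_norm_eq0.
  apply: upper_gradient_weak.
    by split => //; exact: measurable_cst.
  move=> c; rewrite /gradient_ineq subrr normr0.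
  by apply: integral_ge0.
split => //; split; last by rewrite E ltry.
exact: measurable_cst.
Qed.

Lemma NM_class_refl (f : X -> R) : NM_class mu p q f f.
Proof.
rewrite /NM_class/= (_ : (f \- f)%R = fun=> 0%R); first exact: NM_null0.
by apply/funext => x /=; rewrite subrr.
Qed.

End MorreyNorm.

(** * Arc-length parameterized curves *)

Section ArcLength.
Local Open Scope ereal_scope.
Context {R : realType} {X : pmetricType R}.

(** The lengths of c on [0, s] and on [0, t] are s and t.  Appending t to a
    partition of [0, s] gives one of [0, t] whose sum is larger by the distance
    from c s to c t, so s plus that distance is at most t. *)
Lemma rcurve_mdist_le (c : rcurve X) (s t : R) :
  (0 <= s)%R -> (s <= t)%R -> (t <= curve_len c)%R ->
  (mdist (c s) (c t) <= t - s)%R.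
Proof.
move=> s0; rewrite le_eqVlt => /predU1P[<- _|st tl].
  by rewrite subrr mdistxx.
rewrite lerBrDr addrC -lerBrDr -lee_fin.
have sl : s \in `[0%R, curve_len c].
  by rewrite in_itv/= s0 (le_trans (ltW st)).
have tI : t \in `[0%R, curve_len c].
  by rewrite in_itv/= tl andbT (le_trans s0 (ltW st)).
rewrite -(curve_arclength sl); apply: ge_ereal_sup => _ [P hP ->].
rewrite lee_fin lerBrDr -lee_fin -(curve_arclength tI).
apply: le_ereal_sup_tmp; eexists; last exact: lexx.
exists (rcons P t).
  by rewrite -cats1; apply: itv_partition_cat hP (itv_partition1 st).
congr EFin; rewrite size_rcons big_nat_recr//= -rcons_cons !nth_rcons/= ltnn.
rewrite eqxx ltnS leqnn (itv_partition_nth_size t hP); congr +%R.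
apply: eq_big_nat => n /andP[_ nP].
rewrite -rcons_cons !nth_rcons/= ltnS (ltnW nP) nP.
by rewrite !(set_nth_default t s) //= ltnS ltnW.
Qed.

Lemma measurable_rcurve (c : rcurve X) :
  measurable_fun `[0%R, curve_len c]
    (curve_fun c : R -> g_sigma_algebraType (@open X)).
Proof.
apply: (@measurability _ _ _ (g_sigma_algebraType (@open X)) _ _ (@open X)) => //.
move=> _ [U oU <-].
apply: open_measurable_subspace => //.
by have /continuousP := @curve_continuous _ _ c; apply.
Qed.

Lemma line_integral_ge (c : rcurve X) (g : X -> \bar R) (a b K : R) :
  nonneg_borel g -> (0 <= K)%R -> (0 <= a)%R -> (a <= b)%R -> (b <= curve_len c)%R ->
  (forall t, (a <= t <= b)%R -> K%:E <= g (c t)) ->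
  (K * (b - a))%:E <= line_integral c g.
Proof.
move=> [g0 mg] K0 a0; rewrite le_eqVlt => /predU1P[<- _ _|ab bl Kg].
  by rewrite subrr mulr0; apply: integral_ge0.
have mgc : measurable_fun `[0%R, curve_len c] (g \o c).
  apply: (@measurableT_comp _ _ _ _ (g_sigma_algebraType (@open X)) _ g) => //.
  exact: measurable_rcurve.
have sub : `[a, b] `<=` `[0%R, curve_len c].
  move=> t/=; rewrite !in_itv/= => /andP[at_ tb].
  by rewrite (le_trans a0)// (le_trans tb).
have -> : (K * (b - a))%:E = \int[lebesgue_measure]_(t in `[a, b]) (cst K%:E) t.
  by rewrite integral_cst//= lebesgue_measure_itv/= lte_fin ab -EFinB -EFinM.
apply: (@le_trans _ _ (\int[lebesgue_measure]_(t in `[a, b]) g (c t))).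
  by apply: ge0_le_integral => //; exact: measurable_funS mgc.
by apply: ge0_subset_integral => // t _; exact: g0.
Qed.

End ArcLength.

(** * Lipschitz functions with bounded support *)

Section LipschitzInclusion.
Local Open Scope ereal_scope.
Context {R : realType} {X : pmetricType R}.
Variable mu : {outer_measure set X -> \bar R}.
Hypothesis hmu : metric_measure mu.

Lemma lipschitz_bounded (f : X -> R) (L : R) (x0 : X) (r0 : R) :
  (forall x y, (`|f x - f y| <= L * mdist x y)%R) ->
  [set x | f x != 0%R] `<=` ball x0 r0 ->
  forall x, (`|f x| <= `|f x0| + `|L| * `|r0|)%R.
Proof.
move=> Lf supp x; have [->|fx0] := eqVneq (f x) 0%R.
  by rewrite normr0 addr_ge0// mulr_ge0.
have := supp x fx0; rewrite ballEmdist/= => xr.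
rewrite -lerBlDl (le_trans (lerB_dist _ _))// (le_trans (Lf x x0))//.
rewrite (le_trans (ler_norm _))// normrM ler_wpM2l//.
by rewrite metric_sym ger0_norm ?mdist_ge0// (le_trans (ltW xr))// ler_norm.
Qed.

(** One unit of time inside the enlarged ball is enough to pay for the whole
    oscillation 2 M of f, which is why the radius grows by one and why 2 M
    enters the constant; thus what the curve does after it leaves the
    enlarged ball is irrelevant. *)
Lemma lipschitz_gradient_ineq (f : X -> R) (L M : R) (x0 : X) (r0 : R)
    (c : rcurve X) :
  (forall x y, (`|f x - f y| <= L * mdist x y)%R) ->
  [set x | f x != 0%R] `<=` ball x0 r0 ->
  (forall x, (`|f x| <= M)%R) ->
  gradient_ineq f
    (fun x => ((`|L| + 2 * M) * \1_(ball x0 (r0 + 1)) x)%:E) c.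
Proof.
move=> Lf supp fM; set B := ball x0 _; set K := (`|L| + 2 * M)%R.
have M0 : (0 <= M)%R by exact: le_trans (fM x0).
have K0 : (0 <= K)%R by rewrite addr_ge0// mulr_ge0.
set g := fun x => _.
have bg : nonneg_borel g by exact: nonneg_borel_scaled_ball.
rewrite /gradient_ineq; set l := curve_len c.
have l0 : (0 <= l)%R := curve_len_ge0 c.
(* The curve spends at least time m near an end point where f is nonzero. *)
pose m := Num.min 1%R l.
have m0 : (0 <= m)%R by rewrite le_min ler01.
have ml : (m <= l)%R by rewrite ge_min lexx orbT.
have m1 : (m <= 1)%R by rewrite ge_min lexx.
have diffm : (`|f (c 0%R) - f (c l)| <= K * m)%R.
  have [l1|l1] := leP l 1%R.
    have -> : m = l by exact/min_idPr.
    apply: (le_trans (Lf _ _)).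
    have := rcurve_mdist_le (lexx _) l0 (lexx l); rewrite subr0 => cl.
    apply: (@le_trans _ _ (`|L| * mdist (c 0%R) (c l))%R).
      by rewrite ler_wpM2r ?mdist_ge0// ler_norm.
    by apply: ler_pM => //; [exact: mdist_ge0|rewrite lerDl mulr_ge0].
  have -> : m = 1%R by exact/min_idPl/ltW.
  rewrite mulr1 (le_trans (ler_normB _ _))// (@le_trans _ _ (2 * M)%R)//.
    by rewrite mulr_natl mulr2n lerD.
  by rewrite lerDr.
have [f0|/negP f0] := boolP ((f (c 0%R) == 0%R) && (f (c l) == 0%R)).
  move/andP : f0 => [/eqP -> /eqP ->]; rewrite subrr normr0.
  by apply: integral_ge0 => t _; exact: bg.1.
suff [a [a0 aml aB]] : exists a : R, [/\ (0 <= a)%R, (a + m <= l)%R &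
    forall t, (a <= t <= a + m)%R -> B (c t)].
  have := @line_integral_ge _ _ c g a (a + m)%R K bg K0 a0.
  rewrite lerDl m0 addrAC subrr add0r => /(_ isT aml) gc.
  apply: (le_trans _ (gc _)); first by rewrite lee_fin.
  move=> t /aB Bt; rewrite lee_fin /g indicE mem_set//= mulr1//.
have near_end e t : f (c e) != 0%R -> (mdist (c e) (c t) <= m)%R -> B (c t).
  move=> /supp; rewrite /B !ballEmdist/= => e0 et.
  apply: (le_lt_trans (metric_triangle _ (c e) _)); apply: ltr_leD => //.
  exact: le_trans m1.
have [c0|c0] := eqVneq (f (c 0%R)) 0%R.
  exists (l - m)%R; split; rewrite ?subr_ge0 ?subrK// => t /andP[lt tl].
  apply: (near_end l); first by apply/eqP => cl; apply: f0; rewrite c0 cl eqxx.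
  rewrite metric_sym; apply: le_trans (_ : l - t <= _)%R; last first.
    by rewrite lerBlDr addrC -lerBlDr.
  by apply: rcurve_mdist_le => //; rewrite (le_trans _ lt)// subr_ge0.
exists 0%R; rewrite add0r; split => // t /andP[t0 tm].
apply: (near_end 0%R) => //.
have := rcurve_mdist_le (lexx _) t0 (le_trans tm ml).
by rewrite subr0 => /le_trans; apply.
Qed.

Lemma Lip_b_NM_tilde (p q : R) (f : X -> R) : (1 <= p)%R -> (p <= q)%R ->
  Lip_b f -> NM_tilde mu p q f.
Proof.
move=> hp hpq [[L Lf] [x0 [r0 supp0]]].
have supp : [set x | f x != 0%R] `<=` ball x0 r0.
  exact: subset_trans (@subset_closure _ _) supp0.
set M := (`|f x0| + `|L| * `|r0|)%R.
have fM : forall x, (`|f x| <= M)%R := lipschitz_bounded Lf supp.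
have M0 : (0 <= M)%R by exact: le_trans (fM x0).
have mf : measurable_fun [set: caratheodory_type mu] f.
  apply: (borel_fun_caratheodory hmu); apply: continuous_fun_borel.
  exact: lipschitz_continuous Lf.
have mB r : measurable (ball x0 r : set (caratheodory_type mu)).
  exact: (caratheodory_ball hmu).
have bB r : bounded_subset (ball x0 r) by exists x0, r.
split => //.
have K0 : (0 <= `|L| + 2 * M)%R by rewrite addr_ge0// mulr_ge0.
have bg := nonneg_borel_scaled_ball x0 (r0 + 1)%R K0.
apply: (NM_norm_lty (upper_gradient_weak _ _ hp bg _)) => //.
- by move=> c; exact: lipschitz_gradient_ineq.
- apply: (morrey_norm_bounded_support hmu hp hpq M0 _ (mB r0) (bB r0)).
    exact/measurable_EFinP.
  move=> x; rewrite lee_fin; have [->|fx0] := eqVneq (f x) 0%R.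
    by rewrite normr0 mulr_ge0.
  by rewrite indicE mem_set ?mulr1//; exact: supp.
- apply: (morrey_norm_bounded_support hmu hp hpq _ _ (mB (r0 + 1)%R)
    (bB (r0 + 1)%R)); last first.
    by move=> x; rewrite gee0_abs// ?bg.1// ?lee_fin.
  + exact: (borel_fun_caratheodory hmu bg.2).
  + exact: K0.
Qed.

End LipschitzInclusion.

(** * Restriction to a ball *)

Section RestrictionToBall.
Local Open Scope ereal_scope.
Context {R : realType} {X : pmetricType R}.
Variable mu : {outer_measure set X -> \bar R}.
Hypothesis hmu : metric_measure mu.
Variables (x : X) (r : {posnum R}).

Local Notation B := (ball x r%:num).
Local Notation BS := (ball_space x r).
Local Notation muB := (ball_measure mu x r).
Local Notation iota := (@ball_val R X x r).

Lemma ball_val_continuous : continuous iota.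
Proof. exact: initial_continuous. Qed.

Lemma ball_val_inB (y : BS) : B (iota y).
Proof. exact: set_valP. Qed.

(** The measure of the subspace B is the measure of the image in X, so its
    push-forward along the inclusion is A |-> mu (A & B). *)
Lemma image_preimage_ball_val (A : set X) : iota @` (iota @^-1` A) = A `&` B.
Proof.
apply/seteqP; split=> [_ [y Ay <-]|y [Ay By]].
  by split => //; exact: ball_val_inB.
by exists (exist _ y (mem_set By)).
Qed.

(** To test Caratheodory measurability of the trace of A on a subset E of B,
    it suffices to split E, seen as a subset of X, by A itself. *)
Lemma measurable_ball_val :
  measurable_fun [set: caratheodory_type muB]
    (iota : caratheodory_type muB -> caratheodory_type mu).
Proof.
move=> _ A mA; rewrite setTI.
change (muB.-caratheodory (iota @^-1` A)) => E.
rewrite /= /ball_measure /restr_measure.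
have := mA (iota @` E).
rewrite (_ : iota @` E `&` A = iota @` (E `&` iota @^-1` A)); last first.
  apply/seteqP; split=> [_ [[y Ey <-] Ay]|_ [y [Ey Ay] <-]].
    by exists y.
  by split => //; exists y.
rewrite (_ : iota @` E `&` ~` A = iota @` (E `&` ~` (iota @^-1` A))) //.
apply/seteqP; split=> [_ [[y Ey <-] Ay]|_ [y [Ey Ay] <-]].
  by exists y.
by split => //; exists y.
Qed.

Lemma borel_ball_val :
  measurable_fun [set: g_sigma_algebraType (@open BS)]
    (iota : g_sigma_algebraType (@open BS) -> g_sigma_algebraType (@open X)).
Proof.
apply: (@measurability _ _ _ (g_sigma_algebraType (@open X)) _ _ (@open X)) => //.
move=> _ [U oU <-]; rewrite setTI; apply: sub_gen_smallest.
by have /continuousP := ball_val_continuous; apply.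
Qed.

Lemma nonneg_borel_ball_val (rho : X -> \bar R) :
  nonneg_borel rho -> nonneg_borel (rho \o iota).
Proof.
move=> [rho0 mrho]; split; first by move=> y; exact: rho0.
apply: (@measurableT_comp _ _ _ _ (g_sigma_algebraType (@open X)) _ rho) => //.
exact: borel_ball_val.
Qed.

Lemma integral_ball_measure (F : X -> \bar R) : (forall y, 0 <= F y) ->
  measurable_fun [set: caratheodory_type mu] F ->
  \int[cara_measure muB]_y F (iota y) = \int[cara_measure mu]_(y in B) F y.
Proof.
move=> F0 mF.
have mB : measurable (B : set (caratheodory_type mu)).
  exact: caratheodory_ball hmu _ _.
transitivity (\int[pushforward (cara_measure muB)
    (iota : caratheodory_type muB -> caratheodory_type mu)]_(y in B) F y).
  rewrite (ge0_integral_pushforward measurable_ball_val)//; last first.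
    exact: measurable_funS mF.
  congr integral; apply/seteqP; split => // y _.
  exact: ball_val_inB.
apply: eq_measure_integral => [|mi A mA AB]; first exact: measurable_ball_val.
change (mu (iota @` (iota @^-1` A)) = mu A).
by rewrite image_preimage_ball_val; congr (mu _); exact/setIidPl.
Qed.

Variables p q : R.
Hypothesis hp : (1 <= p)%R.

Let p_gt0 : (0 < p)%R. Proof. exact: lt_le_trans hp. Qed.

(** With equal exponents the weight is mu(B')^0 = 1, so every ball B' of the
    subspace contributes at most the L^p norm of F over B; that norm is
    mu(B)^(1/p - 1/q) times the term of the supremum on X given by B. *)
Lemma morrey_norm_ball_val (F : X -> \bar R) :
  measurable_fun [set: caratheodory_type mu] F ->
  morrey_norm muB p p (F \o iota) <=
  mu B `^ (p^-1 - q^-1) * morrey_norm mu p q F.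
Proof.
move=> mF; apply: ge_ereal_sup => _ [y [s ->]].
rewrite subrr poweRe0 mul1e; set B' := ball y _.
have mFp : measurable_fun [set: caratheodory_type mu] (fun z => `|F z| `^ p).
  exact: measurable_abse_poweR.
have mB' : measurable (B' : set (caratheodory_type muB)).
  have := measurable_ball_val measurableT (caratheodory_ball hmu (iota y) s%:num).
  by rewrite setTI.
have I1 : \int[cara_measure muB]_(z in B') (`|F (iota z)| `^ p) <=
    \int[cara_measure mu]_(z in B) (`|F z| `^ p).
  rewrite -integral_ball_measure//; last by move=> z; exact: poweR_ge0.
  apply: ge0_subset_integral => //; last by move=> z _; exact: poweR_ge0.
  apply: (@measurableT_comp _ _ _ _ (caratheodory_type mu) _
    (fun z => `|F z| `^ p)) => //.
  exact: measurable_ball_val.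
have I2 : mu B `^ (q^-1 - p^-1) *
    (\int[cara_measure mu]_(z in B) (`|F z| `^ p)) `^ p^-1 <=
    morrey_norm mu p q F.
  by apply: ereal_sup_ubound; exists x, r.
have [b b0 muBb] := measure_ball_pos_fin hmu x r.
apply: le_trans (lee_wpmul2l (poweR_ge0 _ _) I2).
rewrite muleA muBb !poweR_EFin -EFinM -powRD; last first.
  by rewrite (gt_eqF b0) implybT.
rewrite addrA subrK subrr powRr0 mul1e.
apply: le_poweRr I1; first by rewrite invr_ge0 ltW.
by apply: integral_ge0 => z _; exact: poweR_ge0.
Qed.

Lemma rcurve_ball_continuous (c : rcurve BS) :
  {within `[0%R, curve_len c], continuous (iota \o c)}.
Proof.
move=> t; apply: (@continuous_comp (subspace _) _ _ c iota).
  exact: curve_continuous.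
exact: ball_val_continuous.
Qed.

(** The distance of the subspace is by definition that of X, hence partition
    sums, and so lengths, agree by computation. *)
Lemma rcurve_ball_arclength (c : rcurve BS) (t : R) :
  t \in `[0%R, curve_len c] -> curve_length 0 t (iota \o c) = t%:E.
Proof. exact: (@curve_arclength _ _ c). Qed.

Definition rcurve_of_ball (c : rcurve BS) : rcurve X :=
  RCurve (curve_len_ge0 c) (@rcurve_ball_continuous c)
    (@rcurve_ball_arclength c).

(** A test function admissible for Gamma restricts to one admissible for the
    curves of B that lie in Gamma, at the cost of a constant factor. *)
Lemma Mod_ball_eq0 (Gamma : set (rcurve X)) : Mod mu p q Gamma = 0 ->
  Mod muB p p (rcurve_of_ball @^-1` Gamma) = 0.
Proof.
move=> G0; have [b b0 muBb] := measure_ball_pos_fin hmu x r.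
apply/eqP; rewrite eq_le Mod_ge0 andbT.
pose C := (b `^ (p^-1 - q^-1) `^ p)%R.
have C0 : (0 < C)%R by rewrite !powR_gt0.
suff : Mod muB p p (rcurve_of_ball @^-1` Gamma) <= C%:E * Mod mu p q Gamma.
  by rewrite G0 mule0.
rewrite -ereal_inf_pZl//; apply: le_ereal_inf_tmp => _ [_ [rho [brho adm] <-] <-].
apply: (@le_trans _ _ (morrey_norm muB p p (rho \o iota) `^ p)).
  apply: ereal_inf_lbound; exists (rho \o iota) => //.
  by split; [exact: nonneg_borel_ball_val|move=> c Gc; exact: adm Gc].
rewrite /C -!poweR_EFin -poweRM ?morrey_norm_ge0//; last first.
  by rewrite lee_fin powR_ge0.
apply: le_poweRr; [exact: ltW|exact: morrey_norm_ge0|].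
rewrite -muBb; apply: morrey_norm_ball_val.
exact: (borel_fun_caratheodory hmu brho.2).
Qed.

Lemma weak_upper_gradient_ball (f : X -> R) (g : X -> \bar R) :
  weak_upper_gradient mu p q f g ->
  weak_upper_gradient muB p p (f \o iota) (g \o iota).
Proof.
move=> [bg [Gamma G0 fg]]; split; first exact: nonneg_borel_ball_val.
exists (rcurve_of_ball @^-1` Gamma); first exact: Mod_ball_eq0.
move=> c [t tc ct] Gc; apply: (fg (rcurve_of_ball c)) => //.
by exists t => // /val_inj.
Qed.

Lemma NM_norm_ball (f : X -> R) :
  measurable_fun [set: caratheodory_type mu] f ->
  NM_norm muB p p (f \o iota) <= mu B `^ (p^-1 - q^-1) * NM_norm mu p q f.
Proof.
move=> mf; have [b b0 muBb] := measure_ball_pos_fin hmu x r.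
have C0 : (0 < b `^ (p^-1 - q^-1))%R by rewrite powR_gt0.
rewrite /NM_norm ge0_muleDr ?morrey_norm_ge0//; last first.
  by apply: le_ereal_inf_tmp => _ [g _ <-]; exact: morrey_norm_ge0.
apply: leeD.
  by apply: (@morrey_norm_ball_val (EFin \o f)); exact/measurable_EFinP.
rewrite muBb poweR_EFin -ereal_inf_pZl//.
apply: le_ereal_inf_tmp => _ [_ [g fg <-] <-].
apply: (@le_trans _ _ (morrey_norm muB p p (g \o iota))).
  by apply: ereal_inf_lbound; exists (g \o iota) => //;
    exact: weak_upper_gradient_ball.
rewrite -poweR_EFin -muBb; apply: morrey_norm_ball_val.
exact: (borel_fun_caratheodory hmu fg.1.2).
Qed.

Lemma NM_tilde_ball (f : X -> R) :
  NM_tilde mu p q f -> NM_tilde muB p p (f \o iota).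
Proof.
move=> [mf fy]; split.
  apply: (@measurableT_comp _ _ _ _ (caratheodory_type mu) _ f) => //.
  exact: measurable_ball_val.
have [b b0 muBb] := measure_ball_pos_fin hmu x r.
apply: (le_lt_trans (NM_norm_ball mf)); rewrite muBb poweR_EFin.
by apply: lte_mul_pinfty => //; rewrite lee_fin powR_ge0.
Qed.

Lemma NM_null_ball (f : X -> R) :
  NM_null mu p q f -> NM_null muB p p (f \o iota).
Proof.
move=> [tf f0]; split; first exact: NM_tilde_ball.
apply/eqP; rewrite eq_le NM_norm_ge0 andbT.
by have := NM_norm_ball tf.1; rewrite f0 mule0.
Qed.

End RestrictionToBall.

Theorem theorem2p4 (R : realType) (X : pmetricType R)
    (mu : {outer_measure set X -> \bar R}) (hmu : metric_measure mu)
    (p q : R) (hp : 1 <= p) (hpq : p <= q) :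
  (forall f : X -> R, Lip_b f -> exists2 F, NM mu p q F & F f) /\
  NM mu p q `<=` Newton_loc mu p.
Proof.
split=> [f Lf|_ [f tf <-] x r].
  exists (NM_class mu p q f); last exact: NM_class_refl.
  by exists f => //; exact: Lip_b_NM_tilde.
exists (NM_class (ball_measure mu x r) p p (f \o @ball_val R X x r)).
  by exists (f \o @ball_val R X x r) => //; exact: NM_tilde_ball tf.
by move=> h hf; exact: (NM_null_ball hmu x r hp hf).
Qed.
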